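(* Let $a>b>0$, $c=\sqrt{a^2-b^2}$, and let $O$ be the origin of $\mathbb{R}^2$. Let $P=P(\theta)=(a\cos\theta,b\sin\theta)$, $0\le\theta\le2\pi$, be the moving point with parameter $\theta$ on the ellipse $\vec r(\theta)=(a\cos\theta,b\sin\theta)$. Then: (i) For $\mathcal{D}=|\overrightarrow{OP}|$, we have $$\frac{d^2\mathcal{D}}{d\theta^2}=\frac{c^2(-a^2\cos^4\theta+b^2\sin^4\theta)}{(a^2\cos^2\theta+b^2\sin^2\theta)^{3/2}},\qquad \frac{d\mathcal{D}}{d\theta}\Big|_{\theta=0}=0,\qquad \mathcal{D}|_{\theta=0}=a.$$ (ii) The rotational speed of $\overrightarrow{OP}$ with respect to $\theta$ is $$\frac{ab}{a^2\cos^2\theta+b^2\sin^2\theta}.$$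
   Context: For a nowhere-zero differentiable vector function $\vec w(\theta)$, with $\vec e_{\vec w}=\vec w/|\vec w|$, the rotational speed of $\vec w$ with respect to $\theta$ is $\left|\frac{d\vec e_{\vec w}}{d\theta}\right|$. The parameter $\theta$ may also be taken to range over $(-\infty,+\infty)$. *)

(* Defs.v *)
From Stdlib Require Import Reals.
From Coquelicot Require Import Coquelicot.

Open Scope R_scope.

(** The plane.  Coquelicot's norm on a product is
    [sqrt (norm x ^ 2 + norm y ^ 2)], hence Euclidean here. *)
Definition plane : NormedModule R_AbsRing :=
  prod_NormedModule R_AbsRing R_NormedModule R_NormedModule.

Definition origin : plane := (0, 0).

Definition ellipse (a b theta : R) : plane := (a * cos theta, b * sin theta).

Definition vec (A B : plane) : plane := minus B A.

Definition unit_vector (w : R -> plane) (theta : R) : plane :=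
  scal (/ norm (w theta)) (w theta).

(** A relation rather than a function: it asserts in particular that [w] is a
    nowhere-zero differentiable vector function and that [unit_vector w] has
    a derivative at [theta]. *)
Definition is_rotational_speed (w : R -> plane) (theta s : R) : Prop :=
  (forall t : R, w t <> zero) /\
  (forall t : R, ex_derive w t) /\
  exists v : plane, is_derive (unit_vector w) theta v /\ norm v = s.

(* Main.v *)
Require Import Defs.
From Stdlib Require Import Reals Lra.
From Coquelicot Require Import Coquelicot.

Open Scope R_scope.

(** Write [q = a^2 cos^2 + b^2 sin^2] and [s = sqrt q], so the distance is [s], with [q > 0]
    everywhere. Then [s' = - c^2 cos sin / s], and the quotient rule followed by [s^2 = q] gives the
    second derivative over [s^3] ([is_derive_derivative_of_distance]). The unit vector is
    [(a cos / s, b sin / s)]; differentiating each coordinate and using [sin^2 + cos^2 = 1] gives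
    [(a b / s^3) (- b sin, a cos)] ([is_derive_unit_vector_ellipse]). The vector [(- b sin, a cos)]
    again has length [s], so the rotational speed is [a b / s^2 = a b / q]. *)

Lemma norm_plane (x y : R) : norm ((x, y) : plane) = sqrt (x ^ 2 + y ^ 2).
Proof.
  (* The norm on each factor is the absolute value, so the product norm unfolds to squares of
     absolute values. *)
  rewrite <- (pow2_abs x), <- (pow2_abs y); reflexivity.
Qed.

(** Pairing is the identity of the product space, hence linear and its own differential; the
    two-variable chain rule then differentiates coordinatewise. *)
Lemma is_derive_pair (f g : R -> R) (x df dg : R) :
  is_derive f x df -> is_derive g x dg ->
  is_derive (fun t => (f t, g t) : plane) x ((df, dg) : plane).
Proof.
  intros Hf Hg.
  apply (filterdiff_comp'_2 (W := plane) f g (fun u v => (u, v) : plane) x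
           _ _ (fun u v => (u, v) : plane) Hf Hg).
  apply filterdiff_ext_lin with (fun t : plane => t).
  - apply filterdiff_ext with (fun t : plane => t).
    + intros [u v]; reflexivity.
    + apply filterdiff_id.
  - intros [u v]; reflexivity.
Qed.

Lemma vec_origin_ellipse (a b t : R) :
  vec origin (ellipse a b t) = (a * cos t, b * sin t).
Proof.
  unfold vec, origin, ellipse, minus, plus, opp; simpl.
  unfold prod_plus, prod_opp, plus, opp; simpl.
  f_equal; ring.
Qed.

Definition sqr_dist (a b t : R) : R := a ^ 2 * cos t ^ 2 + b ^ 2 * sin t ^ 2.

Lemma sin_sqr (t : R) : sin t ^ 2 = 1 - cos t ^ 2.
Proof.
  generalize (sin2_cos2 t); unfold Rsqr; lra.
Qed.

(** By Pythagoras the quantity is [b^2 + (a^2 - b^2) cos^2], which is at least [b^2]. *)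
Lemma sqr_dist_pos (a b t : R) : 0 < b < a -> 0 < sqr_dist a b t.
Proof.
  intros H; unfold sqr_dist; rewrite sin_sqr.
  assert (0 < b ^ 2) by (apply pow_lt; lra).
  assert (b ^ 2 < a ^ 2) by nra.
  assert (0 <= cos t ^ 2) by apply pow2_ge_0.
  nra.
Qed.

Lemma norm_vec_origin_ellipse (a b t : R) :
  norm (vec origin (ellipse a b t)) = sqrt (sqr_dist a b t).
Proof.
  rewrite vec_origin_ellipse, norm_plane; unfold sqr_dist; f_equal; ring.
Qed.

Lemma is_derive_sqrt_sqr_dist (a b t : R) : 0 < b < a ->
  is_derive (fun u => sqrt (sqr_dist a b u)) t
    (- (a ^ 2 - b ^ 2) * cos t * sin t / sqrt (sqr_dist a b t)).
Proof.
  intros H; assert (Hq := sqr_dist_pos a b t H).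
  assert (Hs := sqrt_lt_R0 _ Hq).
  unfold sqr_dist in *; auto_derive.
  - exact Hq.
  - simpl in *; field; lra.
Qed.

(** Turns the real exponent of the theorem into an integer power of the square root, which [field]
    can handle. *)
Lemma Rpower_three_halves (x : R) : 0 < x -> Rpower x (3 / 2) = sqrt x ^ 3.
Proof.
  intros Hx.
  replace (3 / 2) with (/ 2 * INR 3) by (simpl; lra).
  rewrite <- Rpower_mult, Rpower_sqrt by exact Hx.
  apply Rpower_pow, sqrt_lt_R0, Hx.
Qed.

Lemma is_derive_derivative_of_distance (a b t : R) : 0 < b < a ->
  is_derive
    (fun u => - (a ^ 2 - b ^ 2) * cos u * sin u / sqrt (sqr_dist a b u)) t
    ((a ^ 2 - b ^ 2) * (- a ^ 2 * cos t ^ 4 + b ^ 2 * sin t ^ 4)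
     / sqrt (sqr_dist a b t) ^ 3).
Proof.
  intros H; assert (Hq := sqr_dist_pos a b t H).
  assert (Hs := sqrt_lt_R0 _ Hq).
  assert (Hsq := sqrt_sqrt _ (Rlt_le _ _ Hq)).
  evar_last.
  - apply is_derive_div.
    + auto_derive; [ exact I | reflexivity ].
    + apply is_derive_sqrt_sqr_dist, H.
    + lra.
  - set (s := sqrt (sqr_dist a b t)) in *.
    unfold sqr_dist in Hsq.
    (* With denominators cleared, [s^2 = q] is the only relation needed: [(cos^2 - sin^2) q + (a^2 -
       b^2) cos^2 sin^2] equals [a^2 cos^4 - b^2 sin^4] as polynomials. *)
    apply Rmult_eq_reg_r with (s ^ 3); [ | apply pow_nonzero; lra ].
    field_simplify; [ | lra | lra ].
    replace (s ^ 2) with (a ^ 2 * cos t ^ 2 + b ^ 2 * sin t ^ 2) by lra.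
    field.
Qed.

Lemma is_derive_unit_vector_ellipse (a b t : R) : 0 < b < a ->
  is_derive (unit_vector (fun u => vec origin (ellipse a b u))) t
    ((- (a * b ^ 2 * sin t) / sqrt (sqr_dist a b t) ^ 3,
      a ^ 2 * b * cos t / sqrt (sqr_dist a b t) ^ 3) : plane).
Proof.
  intros H; assert (Hq := sqr_dist_pos a b t H).
  assert (Hs := sqrt_lt_R0 _ Hq).
  assert (Hsq := sqrt_sqrt _ (Rlt_le _ _ Hq)).
  assert (HC := sin_sqr t).
  apply is_derive_ext with (fun u => (a * cos u / sqrt (sqr_dist a b u),
    b * sin u / sqrt (sqr_dist a b u)) : plane).
  { intros u; unfold unit_vector.
    rewrite norm_vec_origin_ellipse, vec_origin_ellipse.
    unfold scal; simpl; unfold prod_scal, scal; simpl; unfold mult; simpl.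
    f_equal; unfold Rdiv; apply Rmult_comm. }
  apply is_derive_pair; (evar_last;
  [ apply is_derive_div;
    [ auto_derive; [ exact I | reflexivity ]
    | apply is_derive_sqrt_sqr_dist, H
    | lra ]
  | set (s := sqrt (sqr_dist a b t)) in *;
    unfold sqr_dist in Hsq;
    apply Rmult_eq_reg_r with (s ^ 3); [ | apply pow_nonzero; lra ];
    field_simplify; [ | lra | lra ];
    replace (s ^ 2) with (a ^ 2 * cos t ^ 2 + b ^ 2 * sin t ^ 2) by lra ]).
  (* Here Pythagoras is needed: [- q + (a^2 - b^2) cos^2] collapses to [- b^2], and in the other
     coordinate [q + (a^2 - b^2) sin^2] to [a^2]. *)
  - ring_simplify.
    replace (sin t ^ 3) with (sin t * (1 - cos t ^ 2)) by (rewrite <- HC; ring).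
    ring.
  - ring_simplify.
    replace (sin t ^ 2) with (1 - cos t ^ 2) by lra.
    ring.
Qed.

(** The squared length is [a^2 b^2 (b^2 sin^2 + a^2 cos^2) / s^6], that is [a^2 b^2 / s^4], the
    square of a positive number. *)
Lemma norm_derive_unit_vector_ellipse (a b t : R) : 0 < b < a ->
  norm ((- (a * b ^ 2 * sin t) / sqrt (sqr_dist a b t) ^ 3,
         a ^ 2 * b * cos t / sqrt (sqr_dist a b t) ^ 3) : plane)
  = a * b / sqr_dist a b t.
Proof.
  intros H; assert (Hq := sqr_dist_pos a b t H).
  assert (Hs := sqrt_lt_R0 _ Hq).
  assert (Hsq := pow2_sqrt _ (Rlt_le _ _ Hq)).
  rewrite norm_plane; apply sqrt_lem_1.
  - apply Rplus_le_le_0_compat; apply pow2_ge_0.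
  - apply Rlt_le, Rdiv_lt_0_compat; [ apply Rmult_lt_0_compat | ]; lra.
  - set (s := sqrt (sqr_dist a b t)) in *; clearbody s.
    (* Expressing [q] as [s^2] makes both sides rational in the single quantity [s]; the [s^2] left
       after clearing denominators is expanded back. *)
    rewrite <- Hsq.
    unfold sqr_dist in Hsq.
    apply Rmult_eq_reg_r with (s ^ 6); [ | apply pow_nonzero; lra ].
    field_simplify; [ | lra | lra ].
    rewrite Hsq; ring.
Qed.

Theorem proposition5p1 (a b c : R) (hb : 0 < b) (hab : b < a)
    (hc : c = sqrt (a ^ 2 - b ^ 2)) :
  let OP : R -> plane := fun theta => vec origin (ellipse a b theta) in
  let D : R -> R := fun theta => norm (OP theta) in
  ((forall theta : R,
      ex_derive D theta /\
      is_derive_n D 2 theta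
        (c ^ 2 * (- a ^ 2 * cos theta ^ 4 + b ^ 2 * sin theta ^ 4)
         / Rpower (a ^ 2 * cos theta ^ 2 + b ^ 2 * sin theta ^ 2) (3 / 2))) /\
   is_derive D 0 0 /\
   D 0 = a) /\
  (forall theta : R,
     is_rotational_speed OP theta
       (a * b / (a ^ 2 * cos theta ^ 2 + b ^ 2 * sin theta ^ 2))).
Proof.
  intros OP D.
  assert (H : 0 < b < a) by lra.
  assert (HD : forall t, is_derive D t
    (- (a ^ 2 - b ^ 2) * cos t * sin t / sqrt (sqr_dist a b t))).
  { intros t; apply is_derive_ext with (fun u => sqrt (sqr_dist a b u)).
    - intros u; symmetry; apply norm_vec_origin_ellipse.
    - apply is_derive_sqrt_sqr_dist, H. }
  assert (Hc2 : c ^ 2 = a ^ 2 - b ^ 2).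
  { rewrite hc; apply pow2_sqrt; nra. }
  split; [ split; [ intros theta; split | split ]
         | intros theta; split; [ | split ] ].
  - eexists; apply HD.
  - fold (sqr_dist a b theta).
    rewrite Rpower_three_halves, Hc2 by (apply sqr_dist_pos, H).
    apply is_derive_ext with
      (fun u => - (a ^ 2 - b ^ 2) * cos u * sin u / sqrt (sqr_dist a b u)).
    (* The second-order statement concerns the function [Derive D], which the first-derivative
       formula identifies at every point. *)
    + intros u; symmetry; apply is_derive_unique, HD.
    + apply is_derive_derivative_of_distance, H.
  - evar_last; [ apply HD | ].
    rewrite sin_0; unfold Rdiv; ring.
  - unfold D, OP; rewrite norm_vec_origin_ellipse; unfold sqr_dist.
    rewrite sin_0, cos_0.
    replace (a ^ 2 * 1 ^ 2 + b ^ 2 * 0 ^ 2) with (a ^ 2) by ring.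
    apply sqrt_pow2; lra.
  (* Nowhere zero: the norm of [OP t] is the square root of a positive number. *)
  - intros t Ht.
    assert (Hs := sqrt_lt_R0 _ (sqr_dist_pos a b t H)).
    rewrite <- norm_vec_origin_ellipse in Hs; fold (OP t) in Hs.
    rewrite Ht, norm_zero in Hs; lra.
  - intros t; exists ((- (a * sin t), b * cos t) : plane).
    apply is_derive_ext with (fun u => (a * cos u, b * sin u) : plane).
    + intros u; symmetry; apply vec_origin_ellipse.
    + apply is_derive_pair; auto_derive; trivial; ring.
  - eexists; split.
    + apply is_derive_unit_vector_ellipse, H.
    + apply norm_derive_unit_vector_ellipse, H.
Qed.
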